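(* Let $G$ be a finite group that is coprimely invariably generated. If $G$ is soluble, then $d(G)\le 2$.
   Context: For a finite group $G$, $d(G)$ denotes the minimal number of generators of $G$. Write $g^x=x^{-1}gx$. A subset $\{g_1,\dots,g_u\}$ of a finite group $G$ invariably generates $G$ if $\{g_1^{x_1},\dots,g_u^{x_u}\}$ generates $G$ for every choice of $x_1,\dots,x_u\in G$. A finite group $G$ is coprimely invariably generated if there is a set $\{g_1,\dots,g_u\}$ that invariably generates $G$ and such that the orders $|g_1|,\dots,|g_u|$ are pairwise coprime. *)

(* Defs.v *)
From mathcomp Require Import all_boot all_fingroup all_solvable.

Set Implicit Arguments.
Unset Strict Implicit.
Unset Printing Implicit Defensive.

Local Open Scope group_scope.

(* A choice of conjugators x_1, ..., x_u, one for each element of S, is a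
   function x : gT -> gT; only its values on S matter. The set S may be empty. *)
Definition invariably_generates (gT : finGroupType) (G : {group gT})
    (S : {set gT}) : Prop :=
  S \subset G /\
  forall x : gT -> gT, {in S, forall g, x g \in G} ->
    <<[set g ^ x g | g in S]>> = G.

Definition coprimely_invariably_generated (gT : finGroupType)
    (G : {group gT}) : Prop :=
  exists S : {set gT},
    invariably_generates G S /\
    {in S &, forall g h, g != h -> coprime #[g] #[h]}.

(* Main.v *)
(* In a minimal counterexample G, let N be a minimal normal subgroup and x, y
   generators of G modulo N. As x n and y m never generate G, each of the
   |N|^2 subgroups <x n, y m> is a complement of N, and projecting G to N along
   it is a derivation. With the trivial derivation this makes more than
   |N|^2 of them, so for any g1 in G more than |N| derivations vanish at g1.
   At most |N| derivations vanish on the centraliser of N, these being inner, so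
   some f vanishes at g1 but not on that centraliser. Let g1 be the one element of
   the coprime invariable generating set whose order may be divisible by p,
   where N is a p-group: every generator then has a conjugate in the kernel of f,
   a proper subgroup of G. *)

Require Import Defs.
From mathcomp Require Import all_boot all_fingroup all_solvable.

Local Open Scope group_scope.

(** A 1-cocycle for the conjugation action, written multiplicatively. Values outside [G] are free,
    so derivations are compared on [G] only. *)
Definition derivation {gT : finGroupType} (G N : {set gT}) (f : gT -> gT) :=
  {in G, forall x, f x \in N} /\ {in G &, forall x y, f (x * y) = f x ^ y * f y}.

(** * Derivations: inner ones, vanishing, and complements *)

Section Derivations.

Context {gT : finGroupType} {N : {group gT}}.
Implicit Types (G H : {group gT}) (f : gT -> gT).

Lemma derivationS {G H f} : H \subset G -> derivation G N f -> derivation H N f.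
Proof.
move=> /subsetP sHG [Nf fM]; split=> [x /sHG/Nf // | x y Hx Hy].
by rewrite fM ?sHG.
Qed.

Lemma derivation1 {G f} : derivation G N f -> f 1 = 1.
Proof.
case=> _ /(_ 1 1 (group1 _) (group1 _)); rewrite mulg1 conjg1 => f11.
by apply: (mulgI (f 1)); rewrite -f11 mulg1.
Qed.

(** Since [[~ x, n] = (n^-1) ^ x * n], these are the inner derivations (coboundaries). *)
Lemma commg_derivation {G n} :
  G \subset 'N(N) -> n \in N -> derivation G N (fun x => [~ x, n]).
Proof.
move=> nNG Nn; split=> [x Gx | x y _ _]; last exact: commMgJ.
by rewrite -[N : {set _}](mulGid N) commgEr mem_mulg // memJ_norm ?groupV // (subsetP nNG).
Qed.

Lemma divg_derivation {G f1 f2} : abelian N -> G \subset 'N(N) ->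
  derivation G N f1 -> derivation G N f2 ->
  derivation G N (fun x => f1 x * (f2 x)^-1).
Proof.
move=> abN /subsetP nNG [Nf1 f1M] [Nf2 f2M]; split=> [x Gx | x y Gx Gy].
  by rewrite groupM ?groupV ?Nf1 ?Nf2.
have cNN := centsP abN; rewrite f1M // f2M // invMg conjMg conjVg -!mulgA.
rewrite [in RHS](mulgA _ (f1 y)) -(cNN (f1 y)) ?Nf1 // -?mulgA.
  by rewrite (cNN (f2 y)^-1) // groupV ?memJ_norm ?Nf2 ?nNG.
by rewrite groupV memJ_norm ?Nf2 ?nNG.
Qed.

Lemma derivation_ker_group_set {G f} :
  derivation G N f -> group_set [set x in G | f x == 1].
Proof.
move=> df; apply/group_setP; split=> [|x y]; first by rewrite inE group1 (derivation1 df) /=.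
rewrite !inE => /andP[Gx /eqP fx1] /andP[Gy /eqP fy1].
by rewrite groupM //= df.2 // fx1 fy1 conj1g mulg1.
Qed.

(** Vanishing of the first cohomology in coprime order, by averaging [f] over [H]. *)
Lemma coprime_derivation_inner {H f} :
    abelian N -> H \subset 'N(N) -> coprime #|N| #|H| -> derivation H N f ->
  exists2 n, n \in N & {in H, forall x, f x = [~ x, n]}.
Proof.
move=> abN /subsetP nNH coNH [Nf fM].
pose phi x := FiniteModule.fmod abN (f x).
pose M := (\sum_(x in H) phi x)%R; pose m := FiniteModule.fmval M.
have Nm : m \in N by apply: FiniteModule.fmodP.
(* With [m] the product of all values of [f] on [H], the witness is the [#|H|]-th root of [m] in
   [N]. *)
exists (m ^+ expg_invn N #|H|) => [|g Hg]; first exact: groupX.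
have fgH : f g ^+ #|H| = [~ g, m].
  (* Substituting [x * g] for [x] in the product gives [m = m ^ g * f g ^+ #|H|]. *)
  have defM : M = (FiniteModule.actr M g + phi g *+ #|H|)%R.
    rewrite {1}/M (reindex_inj (mulIg g)) /=.
    rewrite (eq_bigl [in H]) => [|x]; last by rewrite groupMr.
    transitivity (\sum_(x in H) (FiniteModule.actr (phi x) g + phi g))%R.
      apply: eq_bigr => x Hx; rewrite /phi fM // FiniteModule.fmodM ?memJ_norm ?Nf ?nNH //.
      by rewrite FiniteModule.fmodJ ?nNH.
    rewrite big_split ssralg.GRing.sumr_const /=; congr (_ + _)%R; rewrite /M.
    by apply: (big_rec2 (fun u v => u = FiniteModule.actr v g)) => [|x u v _ ->];
      rewrite ?FiniteModule.act0r ?FiniteModule.actAr.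
  have := congr1 (@FiniteModule.fmval _ _ _) defM.
  rewrite FiniteModule.fmvalA FiniteModule.fmvalZ FiniteModule.fmvalJ ?nNH //.
  rewrite /phi FiniteModule.fmodK ?Nf // -/m => mE.
  by rewrite commgEr conjVg {2}mE mulKg.
rewrite -(expgK coNH (Nf g Hg)) /= fgH !commgEr -expVgn conjXg expgMn //.

by apply: (centsP abN); rewrite // memJ_norm ?groupV ?nNH.
Qed.

(* A chief factor L / 'C_G(N) of G is a q-group for some q != p, since a p-group
   has nontrivial fixed points on N; so f is inner on L, and f minus that inner
   derivation takes values in 'C_N(L) = 1. *)
Lemma cent_derivation_inner {G f} {p : nat} :
    minnormal N G -> p.-abelem N -> solvable G -> N \subset G ->
    derivation G N f -> {in 'C_G(N), forall c, f c = 1} ->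
  exists2 n, n \in N & {in G, forall x, f x = [~ x, n]}.
Proof.
move=> minN abelN solG sNG df fC1.
have [/andP[ntN nNG] minP] := mingroupP minN.
have [pN abN _] := and3P abelN.
have [sGC | ntGC] := boolP (G \subset 'C(N)).
  exists 1; rewrite ?group1 // => x Gx; rewrite commg1 fC1 // inE Gx.
  exact: (subsetP sGC).
have nsC : 'C_G(N) <| G.
  by rewrite /normal subsetIl normsI ?normG // (subset_trans nNG) ?cent_norm.
have nCG := normal_norm nsC.
have ntGb : G / 'C_G(N) != 1.
  by rewrite -subG1 quotient_sub1 // subsetI subxx.
have [Lb minLb sLbG] := minnormal_exists ntGb (normG _).
have [nLb ntLb /is_abelemP[q q_pr abelLb]] :=
  minnormal_solvable minLb sLbG (quotient_sol _ solG).
have [L defLb sCL nsL] := inv_quotientN nsC (introT andP (conj sLbG nLb)).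
have [sLG nLG] := andP nsL.
(* ['C_N(L)] is normalised by [G], so it is 1 or [N]; if it were [N], then [L] would lie in
   ['C_G(N)]. *)
have CNL1 : 'C_N(L) = 1.
  apply/eqP; apply: contraNT ntLb => ntCNL.
  have nCNL : G \subset 'N('C_N(L)).
    by rewrite normsI // (subset_trans nLG) ?cent_norm.
  have /= CNLN := minP 'C_N(L)%G (introT andP (conj ntCNL nCNL)) (subsetIl _ _).

  rewrite defLb -subG1 quotient_sub1 ?(subset_trans sLG nCG) //.
  rewrite subsetI sLG centsC.
  by rewrite -CNLN subsetIr.
have [Q sylQ] := Sylow_exists q L.
have [sQL qQ _] := and3P sylQ.
have sLCQ : L \subset 'C_G(N) * Q.
  rewrite -quotientSK ?(subset_trans sLG nCG) //.
  have := quotient_pHall (subset_trans sQL (subset_trans sLG nCG)) sylQ.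
  move/pHall_id=> -> //.
  by have [] := and3P abelLb; rewrite defLb.
have nNL := subset_trans sLG nNG.
have nNQ := subset_trans sQL nNL.
(* If [p = q], then [N] meets the centre of the [q]-group [N <*> Q]; this intersection is
   centralised by ['C_G(N)] and [Q], hence by [L], against [CNL1]. *)
have coNQ : coprime #|N| #|Q|.
  have [eqpq | neqpq] := eqVneq p q; last first.
    apply: (pnat_coprime pN); apply: sub_in_pnat qQ => r _ /= /[!inE] /eqP->.
    by rewrite eq_sym.
  have qNQ : q.-group (N <*> Q) by rewrite norm_joinEr // pgroupM -eqpq pN eqpq.
  have nsNQ : N <| N <*> Q by rewrite /normal joing_subl join_subG normG.
  have := meet_center_nil (pgroup_nil qNQ) nsNQ ntN.
  rewrite -subG1 => /negP[]; rewrite -CNL1 subsetI subsetIl centsC.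
  rewrite (subset_trans sLCQ) // mul_subG //.
    by rewrite (subset_trans (subsetIr _ _)) // centS ?subsetIl.
  by rewrite centsC (subset_trans (subsetIr _ _)) // subIset // centS ?orbT // joing_subr.
have [n Nn fnQ] :=
  coprime_derivation_inner abN nNQ coNQ (derivationS (subset_trans sQL sLG) df).
have dn := commg_derivation nNG Nn.
pose h x := f x * [~ x, n]^-1.
have [Nh hM] : derivation G N h := divg_derivation abN nNG df dn.
have hQ : {in Q, forall x, h x = 1} by move=> x Qx; rewrite /h fnQ // mulgV.
have hC : {in 'C_G(N), forall x, h x = 1}.
  move=> x Cx; rewrite /h fC1 // mul1g; apply/eqP; rewrite eq_invg1.
  by apply/commgP; case/setIP: Cx => _ /centP; apply.
have hL : {in L, forall x, h x = 1}.
  move=> x /(subsetP sLCQ)/mulsgP[c y Cc Qy ->].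
  have [Gc _] := setIP Cc; have Gy := subsetP sLG _ (subsetP sQL _ Qy).
  by rewrite hM // hC // hQ // conj1g mulg1.
exists n => // x Gx; apply/eqP; rewrite eq_mulgV1 -/(h x).
have Nhx : h x \in N by apply: Nh.
suff : h x \in 'C_N(L) by rewrite CNL1 => /set1P ->.
rewrite inE Nhx; apply/centP=> y Ly; have Gy := subsetP sLG _ Ly.
have Lyx : y ^ x^-1 \in L by rewrite memJ_norm // groupV (subsetP nLG).
apply/commgP/conjg_fixP.
(* Expanding [h] at [x * y = y ^ x^-1 * x] in both ways, with [h] trivial on [L], gives
   [h x ^ y = h x]. *)
have := hM _ _ Gx Gy; rewrite (hL y) // mulg1 => <-.
have -> : x * y = y ^ x^-1 * x by rewrite conjgE invgK -mulgA mulgKV.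
by rewrite hM ?(subsetP sLG _ Lyx) // (hL _ Lyx) conj1g mul1g.
Qed.

(** By pigeonhole more than [#|N|] of the derivations agree at [g1]; dividing them by one of their
    number makes them vanish there. Were all quotients trivial on ['C_G(N)], they would be inner,
    given by distinct elements of [N]: too many. *)
Lemma derivation_avoiding_cent {G} {p : nat} {I : finType} {A : {set I}}
    {F : I -> gT -> gT} {g1 : gT} :
    minnormal N G -> p.-abelem N -> solvable G -> N \subset G ->
    {in A, forall i, derivation G N (F i)} ->
    {in A &, forall i j, {in G, F i =1 F j} -> i = j} ->
    #|N| * #|N| < #|A| -> g1 \in G ->
  exists f, [/\ derivation G N f, f g1 = 1 & exists2 c, c \in 'C_G(N) & f c != 1].
Proof.
move=> minN abelN solG sNG dF injF ltNA Gg1.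
have [/andP[_ nNG] _] := mingroupP minN; have abN := abelem_abelian abelN.
have [v Nv] : exists2 v, v \in N & #|N| < #|[set i in A | F i g1 == v]|.
  apply/exists_inP; apply: contraLR ltNA; rewrite negb_exists_in -leqNgt => /forall_inP leN.
  rewrite -sum1_card (partition_big (F^~ g1) [in N]) => [|i Ai]; last exact: (dF i Ai).1.
  rewrite -sum_nat_const leq_sum // => v Nv; have := leN v Nv.
  by rewrite -leqNgt -sum1_card; under eq_bigl do rewrite inE.
set J := [set i in A | _] => ltNJ.
have sJA : {subset J <= A} by move=> i /setIdP[].
have /card_gt0P[j Jj] : 0 < #|J| by apply: leq_ltn_trans ltNJ.
pose h i x := F i x * (F j x)^-1.
have dh : {in J, forall i, derivation G N (h i)}.
  by move=> i Ji; apply: divg_derivation abN nNG (dF _ _) (dF _ _); apply: sJA.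
have [/exists_inP[i Ji /exists_inP[c Cc hc]] | ] :=
    boolP [exists i in J, [exists c in 'C_G(N), h i c != 1]].
  exists (h i); split; [exact: dh | | by exists c].
  by move: Ji Jj; rewrite !inE /h => /andP[_ /eqP->] /andP[_ /eqP->]; rewrite mulgV.
move=> noJ.
pose P i n := (n \in N) && [forall x in G, h i x == [~ x, n]].
(* The default 1 is never reached for [i] in [J], by [Pn]. *)
pose n_ i := odflt 1 [pick n | P i n].
have Pn : {in J, forall i, P i (n_ i)}.
  move=> i Ji; rewrite /n_; case: pickP => //= noP.
  have [c Cc | n Nn hn] := cent_derivation_inner minN abelN solG sNG (dh i Ji).
    apply/eqP; apply: contraNT noJ => hc.
    by apply/exists_inP; exists i => //; apply/exists_inP; exists c.
  suff : P i n by rewrite noP.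
  by rewrite /P Nn; apply/forall_inP=> x Gx; rewrite hn.
have injn : {in J &, injective n_}.
  move=> i k Ji Jk eqn; apply: injF; rewrite ?sJA // => x Gx.
  have [/andP[_ /forall_inP/(_ x Gx)/eqP hi] /andP[_ /forall_inP/(_ x Gx)/eqP hk]] :=
    (Pn i Ji, Pn k Jk).
  by apply: (mulIg (F j x)^-1); rewrite -/(h i x) -/(h k x) hi hk eqn.
have: #|N| < #|N| by rewrite (leq_trans ltNJ) // -(card_in_imset injn) subset_leq_card //;
  apply/subsetP=> _ /imsetP[i /Pn/andP[Nn _] ->].
by rewrite ltnn.
Qed.

(* On 'C_G(N) the map f is a G-homomorphism, hence onto N; as
   f (g ^ c) = f g * [~ g, f c] for c in 'C_G(N), each g in S with f g inner has a
   conjugate in the kernel of f. *)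
Lemma invariably_generates_derivation {G} {S : {set gT}} {g1 : gT} {f} :
    minnormal N G -> abelian N -> N \subset G -> invariably_generates G S ->
    {in S, forall g, g != g1 -> coprime #|N| #[g]} ->
    derivation G N f -> f g1 = 1 ->
  {in 'C_G(N), forall c, f c = 1}.
Proof.
move=> minN abN sNG [sSG genS] coS df fg1 c0 Cc0; apply/eqP/negPn/negP => fc0.
have [/andP[_ nNG] minP] := mingroupP minN; have [Nf fM] := df.
have cNN := centsP abN.
have nsC : 'C_G(N) <| G.
  by rewrite /normal subsetIl normsI ?normG // (subset_trans nNG) ?cent_norm.
have cfix c n : c \in 'C_G(N) -> n \in N -> n ^ c = n.
  by case/setIP=> _ /centP cN Nn; apply/conjg_fixP/commgP/commute_sym/cN.
have GC c : c \in 'C_G(N) -> c \in G by case/setIP.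
(* Compare the values of [f] on both sides of [c * g = g * c ^ g]. *)
have fCJ c g : c \in 'C_G(N) -> g \in G -> f (c ^ g) = f c ^ g.
  move=> Cc Gg; have Ccg : c ^ g \in 'C_G(N) by rewrite memJ_norm ?(subsetP (normal_norm nsC)).
  have := congr1 f (conjgC c g); rewrite (fM c g (GC _ Cc) Gg)
    (fM g _ Gg (GC _ Ccg)) (cfix _ _ Ccg (Nf _ Gg)).
  by rewrite (cNN (f g) (Nf _ Gg) _ (Nf _ (GC _ Ccg))) => /mulIg.
have imf : group_set (f @: 'C_G(N)).
  apply/group_setP; split=> [|_ _ /imsetP[c Cc ->] /imsetP[d Cd ->]].
    by apply/imsetP; exists 1; rewrite ?group1 ?(derivation1 df).
  by apply/imsetP; exists (c * d); rewrite ?groupM // fM ?GC // cfix ?Nf ?GC.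
have nimf : (f @: 'C_G(N) != 1) && (G \subset 'N(f @: 'C_G(N))).
  apply/andP; split.
    apply: contraNneq fc0 => im1; apply/eqP/set1P.
    by rewrite -[[set 1]]im1 imset_f.
  apply/subsetP=> g Gg; rewrite inE; apply/subsetP=> _ /imsetP[_ /imsetP[c Cc ->] ->].
  by rewrite /= -fCJ // imset_f // memJ_norm // (subsetP (normal_norm nsC)).
have sfN : f @: 'C_G(N) \subset N.
  by apply/subsetP=> _ /imsetP[c Cc ->]; rewrite Nf ?GC.
have defN : f @: 'C_G(N) = N := minP (Group imf) nimf sfN.
(* Conjugators moving the elements of [S] into the kernel of [f]; [xP] shows that the search
   succeeds on [S]. *)
pose x g := odflt 1 [pick c in 'C_G(N) | f (g ^ c) == 1].
have xP : {in S, forall g, x g \in 'C_G(N) /\ f (g ^ x g) = 1}.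
  move=> g Sg; have Gg := subsetP sSG g Sg; rewrite /x.
  case: pickP => [c /andP[Cc /eqP] // | no]; have [eqg | neqg] := eqVneq g g1.
    by have := no 1; rewrite group1 conjg1 eqg fg1 eqxx.
  have sgG : <[g]> \subset G by rewrite cycle_subG.
  have [n Nn fn] := coprime_derivation_inner abN (subset_trans sgG nNG)
    (coS g Sg neqg) (derivationS sgG df).
  (* [f] is [[~ _, n]] on [<[g]>], so [f c = n^-1] makes [f (g ^ c) = [~ g, n] * [~ g, n^-1] =
     1]. *)
  have /imsetP[c Cc defn] : n^-1 \in f @: 'C_G(N) by rewrite defN groupV.
  have /negP[] := no c; rewrite Cc /=.
  have Gc := GC c Cc; have Nfc := Nf c Gc.
  have fgE : f g = f c ^ g * (f c)^-1 by rewrite fn ?cycle_id // commgEr -defn invgK.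
  have := congr1 f (conjgC g c); rewrite (fM g c Gg Gc) (fM c (g ^ c) Gc (groupJ Gg Gc)).
  have -> : f c ^ g ^ c = f c ^ g.
    by rewrite -{1}(cfix c (f c) Cc Nfc) -conjJg cfix // memJ_norm ?(subsetP nNG).
  rewrite (cfix c (f g) Cc (Nf g Gg)) fgE mulgKV -{1}[_ ^ g]mulg1 => /mulgI <-.
  by rewrite eqxx.
pose K := Group (derivation_ker_group_set df).
have sGK : G \subset K.
  rewrite -{1}(genS x) => [|g /xP[/GC]//]; rewrite gen_subG.
  apply/subsetP=> _ /imsetP[g Sg ->]; have [/GC Gx /eqP fx] := xP g Sg.
  by rewrite inE fx andbT groupJ // (subsetP sSG).
by have := subsetP sGK _ (GC _ Cc0); rewrite inE (negPf fc0) andbF.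
Qed.

(** For [k], [l] in [K] and [n], [m] in [N], the [N]-part of [k * n * (l * m)] is [n ^ l * m], and
    [n ^ l = n ^ (l * m)] because [N] is abelian. *)
Lemma remgr_derivation {G} {K : {group gT}} :
  abelian N -> G \subset 'N(N) -> K \subset G -> K :&: N = 1 -> G \subset K * N ->
  derivation G N (remgr K N).
Proof.
move=> abN nNG sKG tiKN /subsetP sGKN; split=> [x /sGKN | x y]; first exact: mem_remgr.
move=> /[dup] Gx /sGKN/mulsgP[k n Kk Nn ->] /[dup] Gy /sGKN/mulsgP[l m Kl Nm ->].
have nNl : l \in 'N(N) by rewrite (subsetP nNG) ?(subsetP sKG).
have Nnl : n ^ l \in N by rewrite memJ_norm.
have eqM : k * n * (l * m) = k * l * (n ^ l * m) by rewrite conjgE !mulgA mulgK.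
rewrite eqM !remgrMid ?(groupM Kk Kl) ?(groupM Nnl Nm) // conjgM.
by congr (_ * m); apply/esym/conjg_fixP/commgP/(centsP abN).
Qed.

End Derivations.

(** * Passage to quotients, and generation by two elements *)

Lemma invariably_generates_quotient (gT : finGroupType) (G N : {group gT}) (S : {set gT}) :
  N <| G -> invariably_generates G S -> invariably_generates (G / N)%G (S / N).
Proof.
move=> nsNG [sSG genS]; have [sNG nNG] := andP nsNG.
have nNS := subset_trans sSG nNG.
split=> [|x xG]; first exact: quotientS.
(* Elements of [S] with the same image receive the same lifted conjugator, so the conjugated set
   maps exactly onto the one prescribed in the quotient. *)
pose y g := repr (x (coset N g)).
have yG : {in S, forall g, y g \in G}.
  move=> g Sg; have Sbg : coset N g \in S / N by rewrite mem_morphim ?(subsetP nNS).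
  have /morphimP[z Nz Gz xz] := xG _ Sbg.
  have : y g \in N :* z by rewrite /y xz -val_coset // mem_repr_coset.
  by case/rcosetP=> n Nn ->; rewrite groupM // (subsetP sNG).
have defG := genS y yG.
have sTG : [set g ^ y g | g in S] \subset G by rewrite -defG subset_gen.
rewrite /= -defG quotient_gen ?(subset_trans sTG) //; congr <<_>>.
rewrite /quotient !morphimEsub ?(subset_trans sTG) //= -!imset_comp.
apply: eq_in_imset => g Sg /=.
by rewrite morphJ ?(subsetP nNG) ?yG ?(subsetP sSG) //= /y coset_reprK.
Qed.

Lemma coprimely_invariably_generated_quotient (gT : finGroupType) (G N : {group gT}) :
  N <| G -> coprimely_invariably_generated G ->
  coprimely_invariably_generated (G / N)%G.
Proof.
move=> nsNG [S [genS coS]]; exists (S / N); split.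
  exact: invariably_generates_quotient.
move=> _ _ /morphimP[g Ng Sg ->] /morphimP[h Nh Sh ->] neq_gh.
have neqgh : g != h by apply: contraNneq neq_gh => ->.
apply: coprime_dvdl (morph_order _ Ng) _.
exact: coprime_dvdr (morph_order _ Nh) (coS g h Sg Sh neqgh).
Qed.

(** [x] and [y] may coincide or be 1, which covers ranks 0 and 1. *)
Lemma grank_le2P (gT : finGroupType) (G : {group gT}) :
  reflect (exists x y, <<[set x; y]>> = G) ('m(G) <= 2).
Proof.
apply: (iffP idP) => [|[x [y <-]]]; last first.
  by rewrite (leq_trans (grank_min _)) // cards2; case: (x != y).
have [B <- <-] := grank_witness G; have [-> _ | [x Bx] leB2] := set_0Vmem B.
  by exists 1, 1; rewrite setUid -/(cycle 1) cycle1 gen0.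
have [Bx0 | [y /setD1P[neqyx By]]] := set_0Vmem (B :\ x).
  by exists x, x; rewrite setUid -(setD1K Bx) Bx0 setU0.
exists x, y; congr <<_>>; apply/eqP.
by rewrite eqEcard subUset !sub1set Bx By cards2 eq_sym neqyx.
Qed.

Theorem theorem1p3 (gT : finGroupType) (G : {group gT})
  (hG : coprimely_invariably_generated G) (solG : solvable G) :
  'm(G) <= 2.
Proof.
have [m leGm] := ubnP #|G|; elim: m => // m IHm in gT G hG solG leGm *.
apply: negbNE; apply/negP => /grank_le2P no2gen.
have ntG : G :!=: 1.
  by apply: contra_notN no2gen => /eqP->; exists 1, 1; rewrite setUid -/(cycle 1) cycle1.
have [N minN sNG] := minnormal_exists ntG (normG G).
have [nNG ntN /is_abelemP[p p_pr abelN]] := minnormal_solvable minN sNG solG.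
have [_ minP] := mingroupP minN.
have [pN abN _] := and3P abelN.
have nsNG : N <| G by apply/andP.
have [x [y [Gx Gy defGb]]] :
    exists x y, [/\ x \in G, y \in G & G / N = <<[set coset N x; coset N y]>>].
  have /grank_le2P[xb [yb defGb]] : 'm(G / N) <= 2.
    apply: (IHm _ (G / N)%G); first exact: coprimely_invariably_generated_quotient.
      exact: quotient_sol.
    exact: leq_trans (ltn_quotient ntN sNG) _.
  have /morphimP[x _ Gx xbE] : xb \in G / N by rewrite -defGb mem_gen ?set21.
  have /morphimP[y _ Gy ybE] : yb \in G / N by rewrite -defGb mem_gen ?set22.
  by exists x, y; rewrite -xbE -ybE.
pose K (u : gT * gT) : {group gT} := [group of <<[set x * u.1; y * u.2]>>].
have NN u : u \in setX N N -> u.1 \in N /\ u.2 \in N by rewrite inE => /andP.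
have sKG u : u \in setX N N -> K u \subset G.
  case/NN=> Nu1 Nu2; rewrite gen_subG subUset !sub1set.
  by rewrite !groupM // (subsetP sNG).
have sGKN u : u \in setX N N -> G \subset K u * N.
  move=> Nu; have nNK := subset_trans (sKG u Nu) nNG.
  rewrite (normC nNK) -quotientSK // defGb gen_subG subUset !sub1set.
  have [Nu1 Nu2] := NN u Nu.
  rewrite -(coset_kerr x Nu1) -(coset_kerr y Nu2).
  by rewrite !mem_quotient // mem_gen ?set21 ?set22.
(* [K u :&: N] is normalised by [K u] and by the abelian [N], hence by [G]. By minimality it is 1 or
   [N], and [N] would force [K u = G], generated by two elements. *)
have tiKN u : u \in setX N N -> K u :&: N = 1.
  move=> Nu; apply/eqP; apply: contra_notT no2gen => ntKN.
  have nKN : G \subset 'N(K u :&: N).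
    rewrite (subset_trans (sGKN u Nu)) // mul_subG //.
      by rewrite normsI ?normG // (subset_trans (sKG u Nu)).
    by rewrite cents_norm // (subset_trans abN) // centS ?subsetIr.
  have KNN : K u :&: N = N.
    by apply: (minP (K u :&: N)%G); rewrite ?subsetIr //; apply/andP.
  exists (x * u.1), (y * u.2); apply/eqP; rewrite eqEsubset sKG //=.
  by rewrite (subset_trans (sGKN u Nu)) // mul_subG // -KNN subsetIl.
(* [None] indexes the trivial derivation, the one extra beyond [#|N| * #|N|]. *)
pose A := None |: [set Some u | u in setX N N].
pose F (o : option (gT * gT)) := if o is Some u then remgr (K u) N else fun=> 1.
have dF : {in A, forall o, derivation G N (F o)}.
  move=> _ /setU1P[-> | /imsetP[u Nu ->]].
    by split=> [? _ | ? ? _ _]; rewrite ?group1 //= conj1g mulg1.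
  by apply: remgr_derivation abN nNG (sKG u Nu) (tiKN u Nu) (sGKN u Nu).
(* As [x = (x * u.1) * u.1^-1] with [x * u.1] in [K u], the values at [x] and [y] recover [u]. *)
have Fx u : u \in setX N N -> F (Some u) x = u.1^-1 /\ F (Some u) y = u.2^-1.
  move=> Nu; have [Nu1 Nu2] := NN u Nu.
  have NVu1 : u.1^-1 \in N by rewrite groupV.
  have NVu2 : u.2^-1 \in N by rewrite groupV.
  split; first by rewrite -{1}(mulgK u.1 x) /F remgrMid ?tiKN ?mem_gen ?set21.
  by rewrite -{1}(mulgK u.2 y) /F remgrMid ?tiKN ?mem_gen ?set22.
(* The projection is the identity on [N], which is nontrivial. *)
have FN u : u \in setX N N -> {in G, F (Some u) =1 F None} -> False.
  move=> Nu eqF; case/negP: ntN; rewrite -subG1; apply/subsetP=> n Nn.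
  by have := eqF n (subsetP sNG n Nn); rewrite /= remgr_id ?tiKN // => ->.
have injF : {in A &, forall o o', {in G, F o =1 F o'} -> o = o'}.
  move=> _ _ /setU1P[-> | /imsetP[u Nu ->]] /setU1P[-> | /imsetP[v Nv ->]] // eqF.
  - by case: (FN v Nv) => z /eqF.
  - by case: (FN u Nu) => z /eqF.
  have [[ux uy] [vx vy]] := (Fx u Nu, Fx v Nv).
  have := eqF x Gx; have := eqF y Gy; rewrite ux uy vx vy => /invg_inj eq2 /invg_inj eq1.
  by rewrite (surjective_pairing u) (surjective_pairing v) eq1 eq2.
have ltNA : #|N| * #|N| < #|A|.
  rewrite cardsU1 card_imset => [|? ? []//]; rewrite cardsX.
  by case: imsetP => // [[]].
have [S [genS coS]] := hG.
(* At most one element of [S] has order divisible by [p]; if there is none, [g1 = 1] serves. *)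
have [g1 Gg1 coSg1] : exists2 g1, g1 \in G & {in S, forall g, g != g1 -> coprime #|N| #[g]}.
  have coNg g : ~~ (p %| #[g]) -> coprime #|N| #[g].
    by move=> p'g; rewrite (pnat_coprime pN) // p'natE.
  have [/exists_inP[g1 Sg1 pg1] | no] := boolP [exists g in S, p %| #[g]].
    exists g1 => [|g Sg neqg]; first by rewrite (subsetP genS.1).
    apply: coNg; apply: contraL (coS g g1 Sg Sg1 neqg) => pg.
    by rewrite /coprime; apply/eqP=> gcd1; have := dvdn_gcd p #[g] #[g1];
      rewrite gcd1 pg pg1 dvdn1 => /eqP p1; rewrite p1 in p_pr.
  exists 1 => [|g Sg _]; first exact: group1.
  by apply: coNg; apply: contraNN no => pg; apply/exists_inP; exists g.
have [f [df fg1 [c Cc /eqP[]]]] :=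
  derivation_avoiding_cent minN abelN solG sNG dF injF ltNA Gg1.
exact: invariably_generates_derivation minN abN sNG genS coSg1 df fg1 _ Cc.
Qed.
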